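(* Let $\beta\in(\frac\pi2,\pi)$ and $\theta_c\in(0,\pi]$, and let $A,\bar r,\lambda,a_\ell$ be real numbers with $0<A\le\bar r$, $\lambda\ne0$, $a_\ell\ge0$. The explicit family $\mathcal F(A,\bar r,\lambda,a_\ell;\beta,\theta_c)$ constitutes a steady state for $(\beta,\theta_c)$ if and only if the following constraints hold: (C1) $0<A<\bar r<1$; (C2) $\lambda<0$; (C3) $0<a_\ell<1$; (C4) $\bar r=r_2(\bar\theta_2)=\frac1{2\lambda}\Big(\sin\bar\theta_2-\sqrt{\sin^2\bar\theta_2+4\lambda^2}\Big)$; (C5) $r_1(\bar\theta_1)=\bar r$; (C6) $z_1(\theta_c)=0$; (C7) $r_1(-\pi/2)<1$ if $\bar\theta_1<-\pi/2$; (C8) $\Gamma_1\cap\Gamma_3=\{(\bar r,\bar z)\}$. Moreover, if (C1)--(C7) hold and (C8') $a_\ell<A$ holds, then (C8) holds.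
   Context: **Steady states.** Fix $\beta\in[\pi/2,\pi)$ and $\theta_c\in[0,\pi]$. A steady state for $(\beta,\theta_c)$ consists of three curves $\Gamma_i=\{(r_i(\alpha),z_i(\alpha)):\alpha\in[0,1]\}$, $i=1,2,3$, with $r_i,z_i\in C^2([0,1])$ (subscript $\alpha$ denotes $d/d\alpha$), such that: (a) $0<r_1,r_3<1$ on $[0,1]$; $0<r_2<1$ on $[0,1)$; $z_1,z_3>0$ on $(0,1]$; $z_2>0$ on $[0,1]$. (b) There are numbers $0<r_1^*<r_3^*<1$, $z_2^*>0$, $\bar r\in(0,1)$, $\bar z>0$ with $(r_1,z_1)(0)=(r_1^*,0)$, $(r_1,z_1)(1)=(\bar r,\bar z)$, $(r_2,z_2)(0)=(\bar r,\bar z)$, $(r_2,z_2)(1)=(1,z_2^* )$, $(r_3,z_3)(0)=(r_3^*,0)$, $(r_3,z_3)(1)=(\bar r,\bar z)$. (c) For each $i$, $r_{i\alpha}^2+z_{i\alpha}^2$ is a positive constant. (d) With $H_i=\frac{r_{i\alpha}z_{i\alpha\alpha}-z_{i\alpha}r_{i\alpha\alpha}}{2(r_{i\alpha}^2+z_{i\alpha}^2)^{3/2}}+\frac{z_{i\alpha}}{2r_i\sqrt{r_{i\alpha}^2+z_{i\alpha}^2}}$, there is a real constant such that $H_1$ and $H_2$ are both identically equal to it, and $H_3\equiv0$ on $[0,1]$. (e) There are continuous $\theta_i:[0,1]\to(-\pi,\pi]$ with $(\cos\theta_i,\sin\theta_i)=(r_{i\alpha},z_{i\alpha})/\sqrt{r_{i\alpha}^2+z_{i\alpha}^2}$,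 and $\theta_1(0)=\theta_c$, $\theta_2(1)=0$, $\theta_3(0)=\pi/2$, $-\theta_1(1)+\theta_3(1)=\beta$, $\theta_2(0)-\theta_3(1)=-\pi+\beta$. (f) No $\Gamma_i$ self-intersects, and any two distinct curves $\Gamma_i,\Gamma_j$ intersect only at $(\bar r,\bar z)$. **The explicit family $\mathcal F(A,\bar r,\lambda,a_\ell;\beta,\theta_c)$.** Set $\bar\theta_3=\arcsin(A/\bar r)$, $\bar\theta_1=\bar\theta_3-\beta$, $\bar\theta_2=\bar\theta_3-\pi+\beta$, $\bar z=A\,\mathrm{arccosh}(\bar r/A)$ (with $\mathrm{arccosh}:[1,\infty)\to[0,\infty)$, $\arcsin:[-1,1]\to[-\pi/2,\pi/2]$), and $\Gamma_1$: $r_1(\theta_1)=\frac{\sin\theta_1-\sqrt{\sin^2\theta_1+4\lambda^2a_\ell^2}}{2\lambda}$, $z_1(\theta_1)=\bar z-\frac1{2\lambda}\int_{\bar\theta_1}^{\theta_1}\Big(\frac{\sin^2x}{\sqrt{\sin^2x+4\lambda^2a_\ell^2}}-\sin x\Big)dx$, $\theta_1\in[\bar\theta_1,\theta_c]$; $\Gamma_2$: $r_2(\theta_2)=\frac{\sin\theta_2-\sqrt{\sin^2\theta_2+4\lambda^2}}{2\lambda}$, $z_2(\theta_2)=\bar z-\frac1{2\lambda}\int_{\bar\theta_2}^{\theta_2}\Big(\frac{\sin^2x}{\sqrt{\sin^2x+4\lambda^2}}-\sin x\Big)dx$, $\theta_2\in[0,\bar\theta_2]$; $\Gamma_3$: $r_3(\theta_3)=\frac{A}{\sin\theta_3}$,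 $z_3(\theta_3)=A\log\Big(\frac{1+\cos\theta_3}{\sin\theta_3}\Big)$, $\theta_3\in[\bar\theta_3,\frac\pi2]$. The family ''constitutes a steady state for $(\beta,\theta_c)$'' if $-\pi<\bar\theta_1<0<\bar\theta_2<\bar\theta_3<\frac\pi2$ and the three curves, reparametrized by $\alpha\in[0,1]$ proportionally to arclength with $\theta_i$ decreasing in $\alpha$ (so $\alpha=0$ corresponds to $\theta_1=\theta_c$, $\theta_2=\bar\theta_2$, $\theta_3=\pi/2$), form a steady state for $(\beta,\theta_c)$. *)

(* Defs.v *)
From Stdlib Require Export Reals Lra.
From Coquelicot Require Export Coquelicot.
Open Scope R_scope.

(** * Parametrized curves in the (r, z) half-plane *)

Record curve := Curve { cr : R -> R; cz : R -> R }.

Definition arc (c : curve) (a b : R) : R * R -> Prop :=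
  fun p => exists t, a <= t <= b /\ p = (cr c t, cz c t).

Definition I01 (x : R) : Prop := 0 <= x <= 1.

(* [f] is C^2 on the closed interval [0,1] with derivatives [f'] and [f''].
   All limits are taken inside [0,1], so they are one-sided at 0 and 1. *)
Definition C2_on_I01 (f f' f'' : R -> R) : Prop :=
  forall x, I01 x ->
    D_in f f' I01 x /\ D_in f' f'' I01 x /\ continue_in f'' I01 x.

Definition C2_curve (c c' c'' : curve) : Prop :=
  C2_on_I01 (cr c) (cr c') (cr c'') /\ C2_on_I01 (cz c) (cz c') (cz c'').

Definition sqspeed (c' : curve) (x : R) : R := cr c' x ^ 2 + cz c' x ^ 2.

Definition constant_sqspeed (c' : curve) : Prop :=
  exists k, 0 < k /\ forall x, I01 x -> sqspeed c' x = k.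

(* Mean curvature of the surface of revolution generated by [c]. *)
Definition mean_curvature (c c' c'' : curve) (x : R) : R :=
  (cr c' x * cz c'' x - cz c' x * cr c'' x)
    / (2 * Rpower (sqspeed c' x) (3 / 2))
  + cz c' x / (2 * cr c x * sqrt (sqspeed c' x)).

Definition tangent_angle (c' : curve) (theta : R -> R) : Prop :=
  forall x, I01 x ->
    continue_in theta I01 x /\ - PI < theta x <= PI /\
    cos (theta x) = cr c' x / sqrt (sqspeed c' x) /\
    sin (theta x) = cz c' x / sqrt (sqspeed c' x).

Definition simple (c : curve) : Prop :=
  forall x y, I01 x -> I01 y -> cr c x = cr c y -> cz c x = cz c y -> x = y.

Definition meet_only_at (S T : R * R -> Prop) (p : R * R) : Prop :=
  forall q, S q /\ T q <-> q = p.

(** * Steady states *)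

Definition steady_state (beta theta_c : R) (c1 c2 c3 : curve) : Prop :=
  exists c1' c2' c3' c1'' c2'' c3'' : curve,
    (C2_curve c1 c1' c1'' /\ C2_curve c2 c2' c2'' /\ C2_curve c3 c3' c3'') /\
    (forall x, 0 <= x <= 1 -> 0 < cr c1 x < 1 /\ 0 < cr c3 x < 1) /\
    (forall x, 0 <= x < 1 -> 0 < cr c2 x < 1) /\
    (forall x, 0 < x <= 1 -> 0 < cz c1 x /\ 0 < cz c3 x) /\
    (forall x, 0 <= x <= 1 -> 0 < cz c2 x) /\
    (exists r1s r3s z2s rb zb : R,
      (0 < r1s /\ r1s < r3s /\ r3s < 1 /\ 0 < z2s /\ 0 < rb < 1 /\ 0 < zb) /\
      (cr c1 0 = r1s /\ cz c1 0 = 0 /\ cr c1 1 = rb /\ cz c1 1 = zb) /\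
      (cr c2 0 = rb /\ cz c2 0 = zb /\ cr c2 1 = 1 /\ cz c2 1 = z2s) /\
      (cr c3 0 = r3s /\ cz c3 0 = 0 /\ cr c3 1 = rb /\ cz c3 1 = zb) /\
      (simple c1 /\ simple c2 /\ simple c3) /\
      (meet_only_at (arc c1 0 1) (arc c2 0 1) (rb, zb) /\
       meet_only_at (arc c1 0 1) (arc c3 0 1) (rb, zb) /\
       meet_only_at (arc c2 0 1) (arc c3 0 1) (rb, zb))) /\
    (constant_sqspeed c1' /\ constant_sqspeed c2' /\ constant_sqspeed c3') /\
    (exists H : R, forall x, I01 x ->
      mean_curvature c1 c1' c1'' x = H /\
      mean_curvature c2 c2' c2'' x = H /\
      mean_curvature c3 c3' c3'' x = 0) /\
    (exists theta1 theta2 theta3 : R -> R,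
      (tangent_angle c1' theta1 /\ tangent_angle c2' theta2 /\
       tangent_angle c3' theta3) /\
      theta1 0 = theta_c /\ theta2 1 = 0 /\ theta3 0 = PI / 2 /\
      - theta1 1 + theta3 1 = beta /\
      theta2 0 - theta3 1 = - PI + beta).

(** * The explicit family *)

(* Inverse of cosh, used on [1, +oo) only. *)
Definition arccosh (x : R) : R := ln (x + sqrt (x ^ 2 - 1)).

Definition theta3bar (A rbar : R) : R := asin (A / rbar).
Definition theta1bar (beta A rbar : R) : R := theta3bar A rbar - beta.
Definition theta2bar (beta A rbar : R) : R := theta3bar A rbar - PI + beta.
Definition zbar (A rbar : R) : R := A * arccosh (rbar / A).

(* Common form of the first two curves; they differ in the starting angle [t0]
   and in the constant [q] under the square root. *)
Definition cmc_curve (lambda q t0 z0 : R) : curve := Curve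
  (fun t => (sin t - sqrt (sin t ^ 2 + q)) / (2 * lambda))
  (fun t => z0 - / (2 * lambda) *
     RInt (fun x => sin x ^ 2 / sqrt (sin x ^ 2 + q) - sin x) t0 t).

Definition gamma1 (beta A rbar lambda al : R) : curve :=
  cmc_curve lambda (4 * lambda ^ 2 * al ^ 2)
    (theta1bar beta A rbar) (zbar A rbar).

Definition gamma2 (beta A rbar lambda : R) : curve :=
  cmc_curve lambda (4 * lambda ^ 2) (theta2bar beta A rbar) (zbar A rbar).

Definition gamma3 (A : R) : curve := Curve
  (fun t => A / sin t)
  (fun t => A * ln ((1 + cos t) / sin t)).

Definition arclength (c : curve) (a b : R) : R :=
  RInt (fun t => sqrt (Derive (cr c) t ^ 2 + Derive (cz c) t ^ 2)) a b.

(* [phi] is the decreasing bijection from [0,1] onto [lo,hi] for which the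
   arclength of [c] between [phi x] and [hi] is proportional to [x]. *)
Definition decreasing_arclength_param
    (c : curve) (lo hi : R) (phi : R -> R) : Prop :=
  phi 0 = hi /\ phi 1 = lo /\
  (forall x y, 0 <= x -> x < y -> y <= 1 -> phi y < phi x) /\
  (forall t, lo <= t <= hi -> exists x, I01 x /\ phi x = t) /\
  (forall x, I01 x -> arclength c (phi x) hi = x * arclength c lo hi).

Definition reparam (c : curve) (phi : R -> R) : curve :=
  Curve (fun x => cr c (phi x)) (fun x => cz c (phi x)).

Definition family_is_steady_state
    (beta theta_c A rbar lambda al : R) : Prop :=
  let t1 := theta1bar beta A rbar in
  let t2 := theta2bar beta A rbar in
  let t3 := theta3bar A rbar in
  let g1 := gamma1 beta A rbar lambda al in
  let g2 := gamma2 beta A rbar lambda in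
  let g3 := gamma3 A in
  (- PI < t1 /\ t1 < 0 /\ 0 < t2 /\ t2 < t3 /\ t3 < PI / 2) /\
  exists phi1 phi2 phi3 : R -> R,
    decreasing_arclength_param g1 t1 theta_c phi1 /\
    decreasing_arclength_param g2 0 t2 phi2 /\
    decreasing_arclength_param g3 t3 (PI / 2) phi3 /\
    steady_state beta theta_c
      (reparam g1 phi1) (reparam g2 phi2) (reparam g3 phi3).

(** * The constraints *)

Definition scalar_constraints (beta theta_c A rbar lambda al : R) : Prop :=
  let t1 := theta1bar beta A rbar in
  let t2 := theta2bar beta A rbar in
  let g1 := gamma1 beta A rbar lambda al in
  let g2 := gamma2 beta A rbar lambda in
  (0 < A /\ A < rbar /\ rbar < 1) /\
  lambda < 0 /\
  (0 < al /\ al < 1) /\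
  (rbar = cr g2 t2 /\
   cr g2 t2 = / (2 * lambda) *
     (sin t2 - sqrt (sin t2 ^ 2 + 4 * lambda ^ 2))) /\
  cr g1 t1 = rbar /\
  cz g1 theta_c = 0 /\
  (t1 < - (PI / 2) -> cr g1 (- (PI / 2)) < 1).

Definition gamma13_constraint (beta theta_c A rbar lambda al : R) : Prop :=
  meet_only_at
    (arc (gamma1 beta A rbar lambda al) (theta1bar beta A rbar) theta_c)
    (arc (gamma3 A) (theta3bar A rbar) (PI / 2))
    (rbar, zbar A rbar).

(* Main.v *)
From Stdlib Require Import Ranalysis5.
Require Import Defs.

(** All three curves are parametrized by their own tangent angle: in each case
    the velocity with respect to the angle [t] is [- w t * (cos t, sin t)] with
    [w > 0].  Passing to arclength, the angle becomes a decreasing C^1 function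
    of the parameter, the curve is C^2, its meridian curvature is [- / w] and
    its mean curvature is [(sin t / r - / w) / 2] ([angle_curve_reparam]).  For
    the first two curves this equals [lambda] ([cmc_curvature]), for the
    catenary it vanishes.  What remains of the definition of a steady state is a
    matter of endpoints, bounds and intersections.

    Necessity of the constraints is read off from values at particular angles;
    for instance [al] is the radius of [gamma1] at angle [0], and [lambda < 0]
    is the positivity of the radius at the junction.

    For sufficiency, the radius of a constant mean curvature arc is a decreasing
    function of the sine of the angle, and every height decreases with the angle
    where the sine is positive and increases where it is negative.  This gives
    the order of the angles (from [rbar < 1], [constrained_angles]), the bounds
    on radii and heights, and the absence of self-intersections.  The curves
    [gamma1] and [gamma2] are separated by the tangent line of [gamma2] at the
    junction ([gamma12_meet]), [gamma2] and [gamma3] by the vertical line through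
    it.  The order of the two contact points with the plane [z = 0] follows from
    the condition on [gamma1] and [gamma3]: a contact point of [gamma1] beyond
    that of the catenary would force a second crossing ([gamma1_foot_left]).
    Finally, if [al < A] then [gamma1] is above the junction while its angle is
    negative, and afterwards its radius is at most [al], too small for the
    catenary ([gamma13_meet_of_neck]). *)

(** * Calculus on an interval *)

Lemma mean_value (f f' : R -> R) (a b : R) :
  a < b -> (forall t, a <= t <= b -> is_derive f t (f' t)) ->
  exists c, f b - f a = f' c * (b - a) /\ a < c < b.
Proof.
  intros Hab Hf. apply MVT_cor2; [exact Hab|].
  intros c Hc. apply is_derive_Reals, Hf, Hc.
Qed.

Lemma increasing_of_derive (f f' : R -> R) (a b : R) :
  a < b -> (forall t, a <= t <= b -> is_derive f t (f' t)) ->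
  (forall t, a < t < b -> 0 < f' t) -> f a < f b.
Proof.
  intros Hab Hf Hpos.
  destruct (mean_value f f' a b Hab Hf) as (c & Hc & Hin).
  specialize (Hpos c Hin). nra.
Qed.

Lemma decreasing_of_derive (f f' : R -> R) (a b : R) :
  a < b -> (forall t, a <= t <= b -> is_derive f t (f' t)) ->
  (forall t, a < t < b -> f' t < 0) -> f b < f a.
Proof.
  intros Hab Hf Hneg.
  destruct (mean_value f f' a b Hab Hf) as (c & Hc & Hin).
  specialize (Hneg c Hin). nra.
Qed.

Lemma is_derive_D_in (f f' : R -> R) (D : R -> Prop) (x : R) :
  is_derive f x (f' x) -> D_in f f' D x.
Proof.
  intros Hf eps Heps.
  apply is_derive_Reals in Hf.
  destruct (Hf eps Heps) as [d Hd].
  exists d; split; [apply cond_pos|].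
  intros y [[_ Hne] Hy]. simpl in *. unfold Rdist in *.
  replace y with (x + (y - x)) at 1 by ring.
  apply Hd; [lra|exact Hy].
Qed.

Lemma continuity_pt_continue_in (f : R -> R) (D : R -> Prop) (x : R) :
  continuity_pt f x -> continue_in f D x.
Proof.
  intros Hf eps Heps.
  destruct (Hf eps Heps) as (d & Hd & H).
  exists d; split; [exact Hd|].
  intros y [[_ Hne] Hy]. apply H. repeat split; assumption.
Qed.

Lemma is_derive_continuity_pt (f : R -> R) (x l : R) :
  is_derive f x l -> continuity_pt f x.
Proof.
  intros Hf. apply continuity_pt_filterlim.
  apply (ex_derive_continuous f x). exists l; exact Hf.
Qed.

(** A derivative at least [m > 0] makes [F] expand distances by the factor [m],
    hence bijective with a Lipschitz inverse; the difference quotients of the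
    inverse are the reciprocals of those of [F]. *)
Lemma inverse_of_expanding (F w : R -> R) (m : R) :
  0 < m -> (forall t, m <= w t) -> (forall t, is_derive F t (w t)) ->
  exists psi : R -> R,
    (forall y, F (psi y) = y) /\ (forall t, psi (F t) = t) /\
    (forall y, is_derive psi y (/ w (psi y))).
Proof.
  intros Hm Hw HF.
  assert (Hexp : forall s t, s < t -> m * (t - s) <= F t - F s).
  { intros s t Hst.
    destruct (mean_value F w s t Hst) as (c & Hc & _); [intros; apply HF|].
    rewrite Hc. specialize (Hw c). nra. }
  assert (Hinj : forall s t, F s = F t -> s = t).
  { intros s t E.
    destruct (Rtotal_order s t) as [H|[H|H]]; auto;
      specialize (Hexp _ _ H); nra. }
  assert (Hsurj : forall y, {t : R | F t = y}).
  { (* [F] moves by more than [|y - F 0|] over an interval of length [K]. *)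
    intros y. set (K := (Rabs (y - F 0) + 1) / m).
    assert (HK : m * K = Rabs (y - F 0) + 1) by (unfold K; field; lra).
    assert (HK0 : 0 < K).
    { unfold K. apply Rdiv_lt_0_compat; [|lra].
      pose proof (Rabs_pos (y - F 0)); lra. }
    pose proof (Hexp 0 K HK0) as H1.
    pose proof (Hexp (- K) 0 ltac:(lra)) as H2.
    pose proof (Rle_abs (y - F 0)) as H3.
    pose proof (Rabs_maj2 (y - F 0)) as H4.
    destruct (IVT_gen F (- K) K y) as [t [_ Ht]].
    - intros t. exact (is_derive_continuity_pt F t _ (HF t)).
    - rewrite Rmin_left, Rmax_right; lra.
    - exists t; exact Ht. }
  assert (exists psi, forall y, F (psi y) = y) as [psi Hright].
  { exists (fun y => proj1_sig (Hsurj y)). intros y. exact (proj2_sig (Hsurj y)). }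
  exists psi.
  split; [exact Hright|]. split; [intros t; apply Hinj, Hright|].
  intros y. apply is_derive_Reals. intros eps Heps.
  pose proof (proj1 (is_derive_Reals _ _ _) (HF (psi y))) as Hy.
  (* [|k / h - / w| = |h / k - w| / (h / k * w)], with denominator at least
     [m * m]. *)
  destruct (Hy (eps * (m * m))) as [d Hd]; [apply Rmult_lt_0_compat; nra|].
  assert (Hpos : 0 < m * d) by (apply Rmult_lt_0_compat; [lra|apply cond_pos]).
  exists (mkposreal _ Hpos). intros h Hh0 Hh. simpl in Hh.
  set (k := psi (y + h) - psi y).
  assert (Hk : F (psi y + k) - F (psi y) = h).
  { unfold k. replace (psi y + (psi (y + h) - psi y)) with (psi (y + h)) by ring.
    rewrite !Hright. ring. }
  assert (Hk0 : k <> 0).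
  { intros E. rewrite E, Rplus_0_r in Hk. lra. }
  assert (Hquot : m <= h / k).
  { destruct (Rtotal_order k 0) as [Hneg|[E|Hp]]; [|contradiction|].
    - pose proof (Hexp (psi y + k) (psi y) ltac:(lra)).
      apply Rmult_le_reg_r with (- k); [lra|].
      replace (h / k * - k) with (- h) by (field; lra). lra.
    - pose proof (Hexp (psi y) (psi y + k) ltac:(lra)).
      apply Rmult_le_reg_r with k; [lra|].
      replace (h / k * k) with h by (field; lra). lra. }
  assert (Hkd : Rabs k < d).
  { apply Rmult_lt_reg_l with m; [lra|].
    apply Rle_lt_trans with (2 := Hh).
    replace (Rabs h) with (h / k * Rabs k).
    - apply Rmult_le_compat_r; [apply Rabs_pos|exact Hquot].
    - rewrite <- (Rabs_pos_eq (h / k)) by lra. rewrite <- Rabs_mult. f_equal.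
      field; exact Hk0. }
  specialize (Hd k Hk0 Hkd). rewrite Hk in Hd.
  specialize (Hw (psi y)).
  replace (k / h - / w (psi y))
    with (- (h / k - w (psi y)) * / (h / k * w (psi y)))
    by (field; repeat split; lra).
  rewrite Rabs_mult, Rabs_Ropp.
  assert (Hden : m * m <= h / k * w (psi y))
    by (apply Rmult_le_compat; lra).
  rewrite (Rabs_pos_eq (/ _)) by (left; apply Rinv_0_lt_compat; nra).
  apply Rmult_lt_reg_r with (h / k * w (psi y)); [nra|].
  rewrite Rmult_assoc, Rinv_l, Rmult_1_r by nra.
  apply Rlt_le_trans with (1 := Hd).
  apply Rmult_le_compat_l; lra.
Qed.

(** * Parametrization by arclength *)

Lemma decreasing_bounds (phi : R -> R) (lo hi : R) :
  phi 0 = hi -> phi 1 = lo ->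
  (forall x y, 0 <= x -> x < y -> y <= 1 -> phi y < phi x) ->
  forall x, I01 x -> lo <= phi x <= hi.
Proof.
  intros P0 P1 Pdec x [Hx0 Hx1]. rewrite <- P0, <- P1. split.
  - destruct (Req_dec x 1) as [->|]; [lra|]. left; apply Pdec; lra.
  - destruct (Req_dec x 0) as [->|]; [lra|]. left; apply Pdec; lra.
Qed.

Definition clamp (lo hi t : R) : R := Rmax lo (Rmin hi t).

Lemma clamp_in (lo hi t : R) : lo <= hi -> lo <= clamp lo hi t <= hi.
Proof.
  intros H. unfold clamp. split; [apply Rmax_l|].
  apply Rmax_lub; [exact H|apply Rmin_l].
Qed.

Lemma clamp_id (lo hi t : R) : lo <= t <= hi -> clamp lo hi t = t.
Proof.
  intros H. unfold clamp. rewrite Rmin_right, Rmax_right; lra.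
Qed.

Lemma clamp_continuity (lo hi : R) : continuity (clamp lo hi).
Proof.
  intros t eps Heps. exists eps; split; [exact Heps|].
  intros s [_ Hs]. simpl in *. unfold Rdist in *.
  apply Rle_lt_trans with (2 := Hs).
  assert (Hmin : Rabs (Rmin hi s - Rmin hi t) <= Rabs (s - t)).
  { unfold Rmin, Rabs; repeat destruct Rle_dec; repeat destruct Rcase_abs; lra. }
  apply Rle_trans with (2 := Hmin). unfold clamp.
  unfold Rmax, Rabs; repeat destruct Rle_dec; repeat destruct Rcase_abs; lra.
Qed.

(** The extension of [w] by its boundary values has a primitive on the whole
    line, so that the parameter can be obtained as a globally differentiable
    inverse function. *)
Lemma constant_speed_angle (w : R -> R) (lo hi : R) :
  lo < hi ->
  (forall t, lo <= t <= hi -> 0 < w t /\ continuity_pt w t) ->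
  exists (l : R) (phi v : R -> R),
    0 < l /\ phi 0 = hi /\ phi 1 = lo /\
    (forall x y, x < y -> phi y < phi x) /\
    (forall t, lo <= t <= hi -> exists x, I01 x /\ phi x = t) /\
    (forall x, I01 x -> RInt w (phi x) hi = x * l) /\
    (forall x, is_derive phi x (- l / v x)) /\
    (forall x, 0 < v x) /\ continuity v /\
    (forall x, I01 x -> v x = w (phi x)).
Proof.
  intros Hlt Hw.
  set (we := fun t => w (clamp lo hi t)).
  assert (Hwe : forall t, lo <= t <= hi -> we t = w t).
  { intros t Ht. unfold we. rewrite clamp_id; auto. }
  assert (Hcont : continuity we).
  { intros t. apply (continuity_pt_comp (clamp lo hi) w).
    - apply clamp_continuity.
    - apply Hw, clamp_in. lra. }
  destruct (continuity_ab_min w lo hi) as (tm & Hmin & Htm);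
    [lra|intros; apply Hw; assumption|].
  set (m := w tm) in *.
  assert (Hm : 0 < m) by (apply Hw; exact Htm).
  assert (Hmw : forall t, m <= we t).
  { intros t. apply Hmin, clamp_in. lra. }
  assert (Hex : forall a b, ex_RInt we a b).
  { intros a b. apply (ex_RInt_continuous we).
    intros t _. apply continuity_pt_filterlim, Hcont. }
  set (F := (fun t => RInt we lo t) : R -> R).
  assert (HF : forall t, is_derive F t (we t)).
  { intros t. apply (is_derive_RInt we F lo t).
    - apply filter_forall. intros s. apply (RInt_correct we), Hex.
    - apply continuity_pt_filterlim, Hcont. }
  assert (F0 : F lo = 0) by exact (RInt_point lo we).
  destruct (inverse_of_expanding F we m Hm Hmw HF) as (psi & Hr & Hl & Hpsi).
  set (l := F hi).
  assert (Fincr : forall s t, s < t -> F s < F t).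
  { intros s t Hst. apply (increasing_of_derive F we); auto.
    intros u _. specialize (Hmw u). lra. }
  assert (Hl0 : 0 < l) by (rewrite <- F0; apply Fincr, Hlt).
  assert (Hpincr : forall y z, y < z -> psi y < psi z).
  { intros y z Hyz. destruct (Rtotal_order (psi y) (psi z)) as [H|[H|H]]; auto.
    - apply (f_equal F) in H. rewrite !Hr in H. lra.
    - apply Fincr in H. rewrite !Hr in H. lra. }
  set (phi := fun x => psi ((1 - x) * l)).
  assert (P0 : phi 0 = hi).
  { unfold phi. rewrite Rminus_0_r, Rmult_1_l. apply Hl. }
  assert (P1 : phi 1 = lo).
  { unfold phi. replace ((1 - 1) * l) with (F lo) by (rewrite F0; ring). apply Hl. }
  assert (Pdec : forall x y, x < y -> phi y < phi x).
  { intros x y Hxy. apply Hpincr. nra. }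
  assert (Pder : forall x, is_derive phi x (- l / we (phi x))).
  { intros x. unfold phi.
    replace (- l / we (psi ((1 - x) * l)))
      with (scal (- l) (/ we (psi ((1 - x) * l)))) by reflexivity.
    apply (is_derive_comp psi (fun x => (1 - x) * l)); [apply Hpsi|].
    auto_derive; [trivial|ring]. }
  assert (Prange : forall x, I01 x -> lo <= phi x <= hi)
    by (apply decreasing_bounds; auto).
  exists l, phi, (fun x => we (phi x)).
  do 4 (split; [assumption|]). split; [|split; [|split; [exact Pder|split; [|split]]]].
  - intros t Ht. exists (1 - F t / l).
    assert (Ht0 : 0 <= F t).
    { rewrite <- F0. destruct (Req_dec lo t) as [->|]; [lra|].
      left; apply Fincr; lra. }
    assert (Ht1 : F t <= l).
    { unfold l. destruct (Req_dec hi t) as [->|]; [lra|].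
      left; apply Fincr; lra. }
    split.
    + assert (F t / l * l = F t) by (field; lra).
      split; apply Rmult_le_reg_r with l; try lra; nra.
    + unfold phi. replace ((1 - (1 - F t / l)) * l) with (F t) by (field; lra).
      apply Hl.
  - intros x Hx.
    rewrite (RInt_ext w we).
    + assert (H : plus (RInt we lo (phi x)) (RInt we (phi x) hi) = RInt we lo hi)
        by (apply RInt_Chasles; apply Hex).
      change (RInt we lo hi) with l in H.
      change (RInt we lo (phi x)) with (F (phi x)) in H.
      unfold phi in H at 1. rewrite Hr in H. unfold plus in H; simpl in H. lra.
    + pose proof (Prange x Hx). rewrite Rmin_left, Rmax_right by lra.
      intros t Ht. symmetry. apply Hwe. lra.
  - intros x. specialize (Hmw (phi x)). lra.
  - intros x. apply (continuity_pt_comp phi we); [|apply Hcont].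
    exact (is_derive_continuity_pt phi x _ (Pder x)).
  - intros x Hx. apply Hwe, Prange, Hx.
Qed.

(** * Curves parametrized by their tangent angle *)

(** [w] is the radius of curvature of the meridian.  The minus sign means that
    [(cos t, sin t)] is the direction of travel when the angle decreases. *)
Definition angle_curve (c : curve) (w : R -> R) (lo hi : R) : Prop :=
  forall t, lo <= t <= hi ->
    0 < w t /\ continuity_pt w t /\
    is_derive (cr c) t (- w t * cos t) /\ is_derive (cz c) t (- w t * sin t).

Lemma arclength_angle_curve (c : curve) (w : R -> R) (lo hi a : R) :
  angle_curve c w lo hi -> lo <= a <= hi -> arclength c a hi = RInt w a hi.
Proof.
  intros Hc Ha. unfold arclength. apply RInt_ext.
  rewrite Rmin_left, Rmax_right by lra.
  intros t Ht. destruct (Hc t ltac:(lra)) as (Hw & _ & Hr & Hz).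
  rewrite (is_derive_unique _ _ _ Hr), (is_derive_unique _ _ _ Hz).
  transitivity (sqrt (w t ^ 2)); [f_equal|apply sqrt_pow2; lra].
  pose proof (sin2_cos2 t) as E. unfold Rsqr in E.
  transitivity (w t ^ 2 * (sin t * sin t + cos t * cos t)); [ring|].
  rewrite E. ring.
Qed.

Lemma decreasing_arclength_param_bounds (c : curve) (lo hi : R) (phi : R -> R) :
  decreasing_arclength_param c lo hi phi ->
  forall x, I01 x -> lo <= phi x <= hi.
Proof.
  intros (P0 & P1 & Pdec & _). apply decreasing_bounds; assumption.
Qed.

Lemma arc_reparam (c : curve) (lo hi : R) (phi : R -> R) :
  decreasing_arclength_param c lo hi phi ->
  forall q, arc (reparam c phi) 0 1 q <-> arc c lo hi q.
Proof.
  intros H q. split; intros (t & Ht & ->).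
  - exists (phi t). split; [|reflexivity].
    apply (decreasing_arclength_param_bounds c lo hi phi H t Ht).
  - destruct H as (_ & _ & _ & Hsurj & _).
    destruct (Hsurj t Ht) as (x & Hx & <-).
    exists x. split; [exact Hx|reflexivity].
Qed.

Lemma simple_reparam (c : curve) (lo hi : R) (phi : R -> R) :
  decreasing_arclength_param c lo hi phi ->
  (forall s t, lo <= s <= hi -> lo <= t <= hi ->
     cr c s = cr c t -> cz c s = cz c t -> s = t) ->
  simple (reparam c phi).
Proof.
  intros H Hinj x y Hx Hy Er Ez.
  assert (E : phi x = phi y).
  { apply Hinj; try assumption;
      apply (decreasing_arclength_param_bounds c lo hi phi H); assumption. }
  destruct H as (_ & _ & Hdec & _). destruct Hx, Hy.
  destruct (Rtotal_order x y) as [Hlt|[Heq|Hgt]]; [|exact Heq|].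
  - specialize (Hdec x y). lra.
  - specialize (Hdec y x). lra.
Qed.

(** In the arclength parameter the unit tangent is [(cos phi, sin phi)], so
    [phi] is the tangent angle and the meridian has curvature [- / w]; the other
    principal curvature is [sin phi / r]. *)
Lemma angle_curve_reparam (c : curve) (w : R -> R) (lo hi : R) :
  lo < hi -> - PI < lo -> hi <= PI ->
  angle_curve c w lo hi ->
  (forall t, lo <= t <= hi -> cr c t <> 0) ->
  exists (phi : R -> R) (c' c'' : curve),
    decreasing_arclength_param c lo hi phi /\
    C2_curve (reparam c phi) c' c'' /\
    constant_sqspeed c' /\
    tangent_angle c' phi /\
    (forall x, I01 x -> mean_curvature (reparam c phi) c' c'' x =
       (sin (phi x) / cr c (phi x) - / w (phi x)) / 2).
Proof.
  intros Hlt Hlo Hhi Hc Hr0.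
  destruct (constant_speed_angle w lo hi Hlt) as
    (l & phi & v & Hl & P0 & P1 & Pdec & Psurj & Pint & Pder & Hv & Cv & Ev).
  { intros t Ht. destruct (Hc t Ht) as (H1 & H2 & _). split; assumption. }
  assert (Hpar : decreasing_arclength_param c lo hi phi).
  { assert (Hb : forall x, I01 x -> lo <= phi x <= hi)
      by (apply decreasing_bounds; auto).
    do 2 (split; [assumption|]). split; [intros; apply Pdec; assumption|].
    split; [exact Psurj|].
    intros x Hx.
    rewrite (arclength_angle_curve c w lo hi), (arclength_angle_curve c w lo hi)
      by (auto; lra).
    rewrite Pint by exact Hx. rewrite <- P1 at 1. rewrite Pint by (unfold I01; lra).
    ring. }
  pose proof (decreasing_arclength_param_bounds c lo hi phi Hpar) as Hb.
  set (c' := Curve (fun x => l * cos (phi x)) (fun x => l * sin (phi x))).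
  set (c'' := Curve (fun x => l * l * sin (phi x) / v x)
                    (fun x => - (l * l) * cos (phi x) / v x)).
  assert (Cphi : continuity phi)
    by (intros x; exact (is_derive_continuity_pt phi x _ (Pder x))).
  assert (Csin : continuity (fun x => sin (phi x)))
    by (intros x; apply (continuity_pt_comp phi sin);
        [apply Cphi|apply continuity_sin]).
  assert (Ccos : continuity (fun x => cos (phi x)))
    by (intros x; apply (continuity_pt_comp phi cos);
        [apply Cphi|apply continuity_cos]).
  assert (Hsp : forall x, sqspeed c' x = l ^ 2).
  { intros x. unfold sqspeed, c'; simpl.
    pose proof (sin2_cos2 (phi x)) as E. unfold Rsqr in E. nra. }
  assert (Hsq : forall x, sqrt (sqspeed c' x) = l)
    by (intros x; rewrite Hsp; apply sqrt_pow2; lra).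
  exists phi, c', c''. split; [exact Hpar|].
  split; [|split; [|split]].
  - split; intros x Hx; destruct (Hc (phi x) (Hb x Hx)) as (Hw & _ & Dr & Dz);
      pose proof (Hv x) as Hvx; repeat split.
    + apply is_derive_D_in. simpl.
      replace (l * cos (phi x)) with (scal (- l / v x) (- w (phi x) * cos (phi x))).
      * apply (is_derive_comp (cr c) phi); [exact Dr|apply Pder].
      * unfold scal; simpl; unfold mult; simpl.
        rewrite <- Ev by exact Hx. field; lra.
    + apply is_derive_D_in. simpl.
      auto_derive; [exists (- l / v x); apply Pder|].
      replace (Derive (fun x => phi x) x) with (- l / v x)
        by (symmetry; apply is_derive_unique, Pder).
      field; lra.
    + apply continuity_pt_continue_in. simpl.
      apply (continuity_pt_div (fun x => l * l * sin (phi x)) v); [|apply Cv|lra].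
      apply (continuity_pt_scal (fun x => sin (phi x))), Csin.
    + apply is_derive_D_in. simpl.
      replace (l * sin (phi x)) with (scal (- l / v x) (- w (phi x) * sin (phi x))).
      * apply (is_derive_comp (cz c) phi); [exact Dz|apply Pder].
      * unfold scal; simpl; unfold mult; simpl.
        rewrite <- Ev by exact Hx. field; lra.
    + apply is_derive_D_in. simpl.
      auto_derive; [exists (- l / v x); apply Pder|].
      replace (Derive (fun x => phi x) x) with (- l / v x)
        by (symmetry; apply is_derive_unique, Pder).
      field; lra.
    + apply continuity_pt_continue_in. simpl.
      apply (continuity_pt_div (fun x => - (l * l) * cos (phi x)) v); [|apply Cv|lra].
      apply (continuity_pt_scal (fun x => cos (phi x))), Ccos.
  - exists (l ^ 2). split; [nra|]. intros x _; apply Hsp.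
  - intros x Hx. rewrite Hsq. specialize (Hb x Hx). simpl. repeat split.
    + apply continuity_pt_continue_in, Cphi.
    + lra.
    + lra.
    + field; lra.
    + field; lra.
  - intros x Hx. specialize (Hb x Hx).
    destruct (Hc (phi x) Hb) as (Hw & _).
    unfold mean_curvature. rewrite Hsq, Hsp.
    replace (Rpower (l ^ 2) (3 / 2)) with (l ^ 3).
    + simpl. rewrite (Ev x Hx).
      replace (l * cos (phi x) * (- (l * l) * cos (phi x) / w (phi x)) -
        l * sin (phi x) * (l * l * sin (phi x) / w (phi x)))
        with (- (l * (l * l)) / w (phi x)).
      * field. repeat split; try lra. apply Hr0, Hb.
      * pose proof (sin2_cos2 (phi x)) as E. unfold Rsqr in E.
        transitivity (- (l * (l * l)) *
          (sin (phi x) * sin (phi x) + cos (phi x) * cos (phi x)) / w (phi x)).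
        -- rewrite E. field; lra.
        -- field; lra.
    + rewrite <- (Rpower_pow 2 l), <- (Rpower_pow 3 l) by exact Hl.
      rewrite Rpower_mult. f_equal. simpl. lra.
Qed.

(** * The curves of constant mean curvature *)

Definition cmc_radius (lambda q s : R) : R :=
  (s - sqrt (s ^ 2 + q)) / (2 * lambda).

Definition cmc_weight (lambda q t : R) : R :=
  cmc_radius lambda q (sin t) / sqrt (sin t ^ 2 + q).

Lemma abs_lt_sqrt (q s : R) :
  0 < q -> s < sqrt (s ^ 2 + q) /\ - s < sqrt (s ^ 2 + q).
Proof.
  intros Hq. pose proof (pow2_ge_0 s) as Hs.
  pose proof (sqrt_lt_R0 (s ^ 2 + q) ltac:(lra)) as H0.
  pose proof (pow2_sqrt (s ^ 2 + q) ltac:(lra)) as H1.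
  split; nra.
Qed.

Lemma cmc_radius_pos (lambda q s : R) :
  lambda < 0 -> 0 < q -> 0 < cmc_radius lambda q s.
Proof.
  intros Hl Hq. pose proof (abs_lt_sqrt q s Hq) as [H _].
  unfold cmc_radius.
  replace ((s - sqrt (s ^ 2 + q)) / (2 * lambda))
    with ((sqrt (s ^ 2 + q) - s) / (- (2 * lambda))) by (field; lra).
  apply Rdiv_lt_0_compat; lra.
Qed.

Lemma cmc_radius_decreasing (lambda q s s' : R) :
  lambda < 0 -> 0 < q -> s < s' -> cmc_radius lambda q s' < cmc_radius lambda q s.
Proof.
  intros Hl Hq Hs. unfold cmc_radius.
  pose proof (abs_lt_sqrt q s Hq) as [A1 A2].
  pose proof (abs_lt_sqrt q s' Hq) as [B1 B2].
  pose proof (pow2_ge_0 s) as P. pose proof (pow2_ge_0 s') as P'.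
  pose proof (pow2_sqrt (s ^ 2 + q) ltac:(lra)) as X.
  pose proof (pow2_sqrt (s' ^ 2 + q) ltac:(lra)) as Y.
  set (x := sqrt (s ^ 2 + q)) in *. set (y := sqrt (s' ^ 2 + q)) in *.
  assert (E : (y - x) * (y + x) = (s' - s) * (s' + s)) by nra.
  assert (H : y - s' < x - s) by nra.
  replace ((s' - y) / (2 * lambda)) with ((y - s') * / (- (2 * lambda)))
    by (field; lra).
  replace ((s - x) / (2 * lambda)) with ((x - s) * / (- (2 * lambda)))
    by (field; lra).
  apply Rmult_lt_compat_r; [|exact H].
  apply Rinv_0_lt_compat; lra.
Qed.

Lemma cmc_radius_le (lambda q s s' : R) :
  lambda < 0 -> 0 < q -> s <= s' -> cmc_radius lambda q s' <= cmc_radius lambda q s.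
Proof.
  intros Hl Hq [H| ->]; [|lra].
  left; apply cmc_radius_decreasing; assumption.
Qed.

Lemma cmc_radius_lt_inv (lambda q s s' : R) :
  lambda < 0 -> 0 < q -> cmc_radius lambda q s' < cmc_radius lambda q s -> s < s'.
Proof.
  intros Hl Hq H. apply Rnot_le_lt. intros C.
  pose proof (cmc_radius_le lambda q s' s Hl Hq C). lra.
Qed.

Lemma cmc_radius_0 (lambda a : R) :
  lambda < 0 -> 0 <= a -> cmc_radius lambda (4 * lambda ^ 2 * a ^ 2) 0 = a.
Proof.
  intros Hl Ha. unfold cmc_radius.
  replace (0 ^ 2 + 4 * lambda ^ 2 * a ^ 2) with ((- (2 * lambda * a)) ^ 2) by ring.
  rewrite sqrt_pow2 by nra. field; lra.
Qed.

(** The weight [r / sqrt (sin^2 + q)] turns the curvature balance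
    [sin / r - 1 / w] into [(sin - sqrt (sin^2 + q)) / r = 2 lambda]. *)
Lemma cmc_curvature (lambda q t : R) :
  lambda < 0 -> 0 < q ->
  (sin t / cmc_radius lambda q (sin t) - / cmc_weight lambda q t) / 2 = lambda.
Proof.
  intros Hl Hq. unfold cmc_weight, cmc_radius.
  pose proof (abs_lt_sqrt q (sin t) Hq) as [H1 H2].
  field. repeat split; lra.
Qed.

Lemma cmc_angle_curve (lambda q t0 z0 lo hi : R) :
  lambda < 0 -> 0 < q ->
  angle_curve (cmc_curve lambda q t0 z0) (cmc_weight lambda q) lo hi.
Proof.
  intros Hl Hq t _.
  assert (Hp : forall s, 0 < sin s ^ 2 + q)
    by (intros s; pose proof (pow2_ge_0 (sin s)); lra).
  pose proof (sqrt_lt_R0 _ (Hp t)) as Hs.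
  split; [|split; [|split]].
  - apply Rdiv_lt_0_compat; [apply cmc_radius_pos; assumption|exact Hs].
  - apply continuity_pt_filterlim.
    apply (ex_derive_continuous (cmc_weight lambda q) t).
    unfold cmc_weight, cmc_radius. auto_derive.
    simpl in Hs, Hp. specialize (Hp t).
    repeat split; try exact Hp; apply Rgt_not_eq; exact Hs.
  - unfold cmc_curve; simpl cr. unfold cmc_weight, cmc_radius.
    auto_derive; [apply Hp|].
    simpl in *. field. split; lra.
  - set (f := fun x => sin x ^ 2 / sqrt (sin x ^ 2 + q) - sin x).
    assert (Hf : forall s, continuous f s).
    { intros s. apply (ex_derive_continuous f s). unfold f. auto_derive.
      pose proof (sqrt_lt_R0 _ (Hp s)) as Hs'. simpl in Hs', Hp. specialize (Hp s).
      repeat split; try exact Hp; apply Rgt_not_eq; exact Hs'. }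
    assert (HI : is_derive (fun t => RInt f t0 t) t (f t)).
    { apply (is_derive_RInt f (fun t => RInt f t0 t) t0 t).
      - apply filter_forall. intros s. apply (RInt_correct f).
        apply (ex_RInt_continuous f). intros; apply Hf.
      - apply Hf. }
    unfold cmc_curve; simpl cz. fold f.
    replace (- cmc_weight lambda q t * sin t) with (0 - / (2 * lambda) * f t).
    + apply (is_derive_minus (fun _ => z0) (fun t => / (2 * lambda) * RInt f t0 t)).
      * apply (is_derive_const z0 t).
      * apply (is_derive_scal (fun t => RInt f t0 t) t (/ (2 * lambda)) (f t) HI).
    + unfold f, cmc_weight, cmc_radius. field. split; lra.
Qed.

Lemma cmc_start (lambda q t0 z0 : R) : cz (cmc_curve lambda q t0 z0) t0 = z0.
Proof.
  simpl. rewrite RInt_point. change (z0 - / (2 * lambda) * 0 = z0). ring.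
Qed.

Lemma angle_curve_height_increasing (c : curve) (w : R -> R) (lo hi s t : R) :
  angle_curve c w lo hi -> - PI <= lo -> hi <= 0 -> lo <= s -> s < t -> t <= hi ->
  cz c s < cz c t.
Proof.
  intros Hc Hlo Hhi Hs Hst Ht.
  apply (increasing_of_derive (cz c) (fun u => - w u * sin u)); [exact Hst| |].
  - intros u Hu. apply Hc. lra.
  - intros u Hu. destruct (Hc u ltac:(lra)) as (Hw & _).
    pose proof (sin_lt_0_var u ltac:(lra) ltac:(lra)). nra.
Qed.

Lemma angle_curve_height_decreasing (c : curve) (w : R -> R) (lo hi s t : R) :
  angle_curve c w lo hi -> 0 <= lo -> hi <= PI -> lo <= s -> s < t -> t <= hi ->
  cz c t < cz c s.
Proof.
  intros Hc Hlo Hhi Hs Hst Ht.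
  apply (decreasing_of_derive (cz c) (fun u => - w u * sin u)); [exact Hst| |].
  - intros u Hu. apply Hc. lra.
  - intros u Hu. destruct (Hc u ltac:(lra)) as (Hw & _).
    pose proof (sin_gt_0 u ltac:(lra) ltac:(lra)). nra.
Qed.

(** Signed distance, positive on the left, from the point of parameter [t] to
    the line of direction angle [u] through the point of parameter [s]. *)
Definition line_offset (c : curve) (u s t : R) : R :=
  (cz c t - cz c s) * cos u - (cr c t - cr c s) * sin u.

(** The derivative of the offset is [w x * sin (u - x)]. *)
Lemma line_offset_increasing (c : curve) (w : R -> R) (lo hi u s t : R) :
  angle_curve c w lo hi -> lo <= s -> s < t -> t <= hi ->
  t <= u -> u - s <= PI ->
  forall p, line_offset c u p s < line_offset c u p t.
Proof.
  intros Hc Hs Hst Ht Hu Hsu p.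
  apply (increasing_of_derive (line_offset c u p) (fun x => w x * sin (u - x)));
    [exact Hst| |].
  - intros x Hx. destruct (Hc x ltac:(lra)) as (_ & _ & Dr & Dz).
    unfold line_offset.
    auto_derive; [split; [|split; [|trivial]]; eexists; eassumption|].
    replace (Derive (fun x => cr c x) x) with (- w x * cos x)
      by (symmetry; apply is_derive_unique, Dr).
    replace (Derive (fun x => cz c x) x) with (- w x * sin x)
      by (symmetry; apply is_derive_unique, Dz).
    rewrite sin_minus. ring.
  - intros x Hx. destruct (Hc x ltac:(lra)) as (Hw & _).
    apply Rmult_lt_0_compat; [exact Hw|].
    apply sin_gt_0; lra.
Qed.

(** * The catenary *)

Lemma catenary_cosh (A t : R) :
  0 < A -> 0 < t <= PI / 2 -> cr (gamma3 A) t = A * cosh (cz (gamma3 A) t / A).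
Proof.
  intros HA Ht. simpl.
  assert (Hs : 0 < sin t) by (apply sin_gt_0; pose proof PI_RGT_0; lra).
  assert (Hc : 0 <= cos t) by (apply cos_ge_0; lra).
  pose proof (sin2_cos2 t) as E. unfold Rsqr in E.
  replace (A * ln ((1 + cos t) / sin t) / A) with (ln ((1 + cos t) / sin t))
    by (field; lra).
  unfold cosh. rewrite exp_Ropp, exp_ln by (apply Rdiv_lt_0_compat; lra).
  replace ((1 + cos t) / sin t + / ((1 + cos t) / sin t)) with
    ((1 + 2 * cos t + (sin t * sin t + cos t * cos t)) / (sin t * (1 + cos t)))
    by (field; lra).
  rewrite E. field. lra.
Qed.

Lemma catenary_angle_curve (A lo : R) :
  0 < A -> 0 < lo -> angle_curve (gamma3 A) (fun t => A / sin t ^ 2) lo (PI / 2).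
Proof.
  intros HA Hlo t Ht.
  assert (Hs : 0 < sin t) by (apply sin_gt_0; pose proof PI_RGT_0; lra).
  assert (Hc : 0 <= cos t) by (apply cos_ge_0; lra).
  split; [|split; [|split]].
  - apply Rdiv_lt_0_compat; nra.
  - apply continuity_pt_filterlim.
    apply (ex_derive_continuous (fun t => A / sin t ^ 2) t).
    auto_derive. nra.
  - simpl cr. auto_derive; [lra|]. field. lra.
  - simpl cz. auto_derive; [split; [lra|split; [|trivial]]|].
    + apply Rdiv_lt_0_compat; lra.
    + assert (E : cos t ^ 2 = 1 - sin t ^ 2)
        by (pose proof (sin2_cos2 t) as E; unfold Rsqr in E; lra).
      field_simplify_eq; [|split; lra]. ring [E].
Qed.

(** The closed form of [zbar] is the height of the catenary at radius [rbar],
    since [(1 + cos t) / sin t = / x + sqrt ((/ x) ^ 2 - 1)] for [x = sin t]. *)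
Lemma catenary_junction (A rbar : R) :
  0 < A -> A < rbar ->
  0 < theta3bar A rbar < PI / 2 /\
  cr (gamma3 A) (theta3bar A rbar) = rbar /\
  cz (gamma3 A) (theta3bar A rbar) = zbar A rbar.
Proof.
  intros HA Hr. unfold theta3bar.
  set (x := A / rbar).
  assert (Hx0 : 0 < x) by (apply Rdiv_lt_0_compat; lra).
  assert (Hx1 : x < 1).
  { apply Rmult_lt_reg_r with rbar; [lra|].
    unfold x. replace (A / rbar * rbar) with A by (field; lra). lra. }
  assert (Hs : sin (asin x) = x) by (apply sin_asin; lra).
  assert (Hb : - (PI / 2) < asin x < PI / 2) by (apply asin_bound_lt; lra).
  assert (H0 : 0 < asin x).
  { apply Rnot_le_lt. intros C. pose proof PI_RGT_0.
    destruct C as [C|C].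
    - pose proof (sin_lt_0_var (asin x) ltac:(lra) C). lra.
    - rewrite C, sin_0 in Hs. lra. }
  split; [lra|]. split; simpl; rewrite Hs.
  - unfold x. field. lra.
  - unfold zbar, arccosh. f_equal. f_equal.
    rewrite cos_asin by lra.
    replace (rbar / A) with (/ x) by (unfold x; field; lra).
    replace ((/ x) ^ 2 - 1) with ((1 - x²) * (/ x) ^ 2)
      by (unfold Rsqr; field; lra).
    rewrite sqrt_mult_alt by (unfold Rsqr; nra).
    rewrite sqrt_pow2 by (left; apply Rinv_0_lt_compat; lra).
    field. lra.
Qed.

Lemma catenary_foot (A : R) :
  cr (gamma3 A) (PI / 2) = A /\ cz (gamma3 A) (PI / 2) = 0.
Proof.
  simpl. rewrite sin_PI2, cos_PI2. split; [field|].
  replace ((1 + 0) / 1) with 1 by field. rewrite ln_1. ring.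
Qed.

Lemma catenary_radius_bounds (A lo t : R) :
  0 < A -> 0 < lo -> lo <= t <= PI / 2 ->
  A <= cr (gamma3 A) t <= cr (gamma3 A) lo.
Proof.
  intros HA Hlo Ht. simpl. pose proof PI_RGT_0.
  pose proof (sin_gt_0 lo ltac:(lra) ltac:(lra)).
  pose proof (sin_gt_0 t ltac:(lra) ltac:(lra)).
  pose proof (SIN_bound t).
  assert (sin lo <= sin t) by (apply sin_incr_1; lra).
  split.
  - apply Rmult_le_reg_r with (sin t); [lra|].
    replace (A / sin t * sin t) with A by (field; lra). nra.
  - apply Rmult_le_compat_l; [lra|]. apply Rinv_le_contravar; lra.
Qed.

Lemma catenary_height_decreasing (A s t : R) :
  0 < A -> 0 < s -> s < t -> t <= PI / 2 ->
  cz (gamma3 A) t < cz (gamma3 A) s.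
Proof.
  intros HA Hs Hst Ht. pose proof PI_RGT_0.
  apply (angle_curve_height_decreasing (gamma3 A) (fun t => A / sin t ^ 2) s (PI / 2));
    try lra.
  apply catenary_angle_curve; assumption.
Qed.

Lemma zbar_pos (A rbar : R) : 0 < A -> A < rbar -> 0 < zbar A rbar.
Proof.
  intros HA Hr.
  destruct (catenary_junction A rbar HA Hr) as (Ht & _ & <-).
  rewrite <- (proj2 (catenary_foot A)).
  apply catenary_height_decreasing; lra.
Qed.

(** * The two constant mean curvature arcs *)

Definition q1 (lambda al : R) : R := 4 * lambda ^ 2 * al ^ 2.
Definition q2 (lambda : R) : R := 4 * lambda ^ 2.

Lemma q1_pos (lambda al : R) : lambda < 0 -> 0 < al -> 0 < q1 lambda al.
Proof.
  intros Hl Ha. unfold q1. apply Rmult_lt_0_compat; [|nra].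
  apply Rmult_lt_0_compat; nra.
Qed.

Lemma q2_pos (lambda : R) : lambda < 0 -> 0 < q2 lambda.
Proof. intros Hl. unfold q2. nra. Qed.

Lemma q2_radius_0 (lambda : R) : lambda < 0 -> cmc_radius lambda (q2 lambda) 0 = 1.
Proof.
  intros Hl. rewrite <- (cmc_radius_0 lambda 1) by lra.
  unfold q2. f_equal. ring.
Qed.

Lemma gamma1_angle_curve (beta A rbar lambda al lo hi : R) :
  lambda < 0 -> 0 < al ->
  angle_curve (gamma1 beta A rbar lambda al) (cmc_weight lambda (q1 lambda al)) lo hi.
Proof. intros Hl Ha. apply cmc_angle_curve; [exact Hl|apply q1_pos; assumption]. Qed.

Lemma gamma2_angle_curve (beta A rbar lambda lo hi : R) :
  lambda < 0 ->
  angle_curve (gamma2 beta A rbar lambda) (cmc_weight lambda (q2 lambda)) lo hi.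
Proof. intros Hl. apply cmc_angle_curve; [exact Hl|apply q2_pos; assumption]. Qed.

Lemma gamma1_radius_left (beta A rbar lambda al t : R) :
  lambda < 0 -> 0 < al -> 0 <= t <= PI ->
  cr (gamma1 beta A rbar lambda al) t <= al.
Proof.
  intros Hl Ha Ht. rewrite <- (cmc_radius_0 lambda al) at 2 by lra.
  apply (cmc_radius_le lambda (q1 lambda al) 0 (sin t) Hl).
  - apply q1_pos; assumption.
  - apply sin_ge_0; lra.
Qed.

Lemma gamma1_radius_right (beta A rbar lambda al t : R) :
  lambda < 0 -> 0 < al -> - PI < t < 0 ->
  al < cr (gamma1 beta A rbar lambda al) t.
Proof.
  intros Hl Ha Ht. rewrite <- (cmc_radius_0 lambda al) at 1 by lra.
  apply (cmc_radius_decreasing lambda (q1 lambda al) (sin t) 0 Hl).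
  - apply q1_pos; assumption.
  - apply sin_lt_0_var; lra.
Qed.

(** The bound [rbar < 1] is what makes [theta2bar] positive: on [gamma2] the
    radius decreases with the sine of the angle and equals [1] at sine [0]. *)
Lemma constrained_angles (beta theta_c A rbar lambda al : R) :
  PI / 2 < beta < PI ->
  scalar_constraints beta theta_c A rbar lambda al ->
  - PI < theta1bar beta A rbar < 0 /\ 0 < theta2bar beta A rbar /\
  theta2bar beta A rbar < theta3bar A rbar /\
  0 < theta3bar A rbar < PI / 2.
Proof.
  intros Hb ((HA & HAr & Hr1) & Hl & _ & (C4 & _) & _).
  destruct (catenary_junction A rbar HA HAr) as (Ht3 & _ & _).
  unfold theta1bar. repeat split; try lra.
  - apply Rnot_le_lt. intros C.
    change (rbar = cmc_radius lambda (q2 lambda) (sin (theta2bar beta A rbar))) in C4.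
    rewrite C4, <- (q2_radius_0 lambda Hl) in Hr1.
    apply cmc_radius_lt_inv in Hr1; [|exact Hl|apply q2_pos, Hl].
    destruct C as [C|C].
    + unfold theta2bar in *.
      pose proof (sin_lt_0_var (theta3bar A rbar - PI + beta) ltac:(lra) C). lra.
    + rewrite C, sin_0 in Hr1. lra.
  - unfold theta2bar; lra.
Qed.

Lemma gamma1_height_left (beta A rbar lambda al t : R) :
  lambda < 0 -> 0 < al -> - PI < theta1bar beta A rbar ->
  theta1bar beta A rbar < t <= 0 ->
  zbar A rbar < cz (gamma1 beta A rbar lambda al) t.
Proof.
  intros Hl Ha Ht1 Ht.
  rewrite <- (cmc_start lambda (q1 lambda al) (theta1bar beta A rbar) (zbar A rbar)).
  apply (angle_curve_height_increasing (gamma1 beta A rbar lambda al)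
    (cmc_weight lambda (q1 lambda al)) (theta1bar beta A rbar) 0); try lra.
  apply gamma1_angle_curve; assumption.
Qed.

Lemma gamma1_height_decreasing (beta A rbar lambda al s t : R) :
  lambda < 0 -> 0 < al -> 0 <= s -> s < t -> t <= PI ->
  cz (gamma1 beta A rbar lambda al) t < cz (gamma1 beta A rbar lambda al) s.
Proof.
  intros Hl Ha Hs Hst Ht.
  apply (angle_curve_height_decreasing (gamma1 beta A rbar lambda al)
    (cmc_weight lambda (q1 lambda al)) 0 PI); try lra.
  apply gamma1_angle_curve; assumption.
Qed.

(** The height is monotone on each side of angle [0], and the radius is larger
    than [al] on one side, at most [al] on the other. *)
Lemma gamma1_injective (beta A rbar lambda al hi s t : R) :
  lambda < 0 -> 0 < al -> - PI < theta1bar beta A rbar -> hi <= PI ->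
  theta1bar beta A rbar <= s <= hi -> theta1bar beta A rbar <= t <= hi ->
  let c := gamma1 beta A rbar lambda al in
  cr c s = cr c t -> cz c s = cz c t -> s = t.
Proof.
  intros Hl Ha Ht1 Hhi. revert s t.
  assert (W : forall s t, theta1bar beta A rbar <= s -> s < t -> t <= hi ->
    let c := gamma1 beta A rbar lambda al in
    cr c s = cr c t -> cz c s = cz c t -> False).
  { intros s t Hs Hst Ht c Er Ez.
    destruct (Rlt_or_le s 0) as [Hs0|Hs0].
    - destruct (Rlt_or_le 0 t) as [Ht0|Ht0].
      + pose proof (gamma1_radius_right beta A rbar lambda al s Hl Ha ltac:(lra)).
        pose proof (gamma1_radius_left beta A rbar lambda al t Hl Ha ltac:(lra)).
        unfold c in Er; lra.
      + pose proof (angle_curve_height_increasing c (cmc_weight lambda (q1 lambda al))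
          (theta1bar beta A rbar) 0 s t
          (gamma1_angle_curve beta A rbar lambda al _ _ Hl Ha)). lra.
    - pose proof (gamma1_height_decreasing beta A rbar lambda al s t Hl Ha Hs0 Hst).
      unfold c in Ez; lra. }
  intros s t Hs Ht c Er Ez.
  destruct (Rtotal_order s t) as [H|[H|H]]; [exfalso|exact H|exfalso].
  - apply (W s t); try lra; assumption.
  - apply (W t s); try lra; symmetry; assumption.
Qed.

(** The radius is largest where the sine is smallest: at angle [- PI / 2] if the
    arc reaches it, at the junction otherwise. *)
Lemma gamma1_radius_lt_1 (beta theta_c A rbar lambda al t : R) :
  PI / 2 < beta < PI -> theta_c <= PI ->
  scalar_constraints beta theta_c A rbar lambda al ->
  theta1bar beta A rbar <= t <= theta_c ->
  cr (gamma1 beta A rbar lambda al) t < 1.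
Proof.
  intros Hb Hc HS Ht.
  pose proof (constrained_angles _ _ _ _ _ _ Hb HS) as (Ht1 & _).
  destruct HS as ((HA & HAr & Hr1) & Hl & (Ha & _) & _ & C5 & _ & C7).
  pose proof (q1_pos lambda al Hl Ha) as Hq.
  destruct (Rlt_or_le (theta1bar beta A rbar) (- (PI / 2))) as [H|H].
  - apply Rle_lt_trans with (2 := C7 H).
    apply (cmc_radius_le lambda (q1 lambda al) _ _ Hl Hq).
    rewrite sin_neg, sin_PI2. apply SIN_bound.
  - apply Rle_lt_trans with (2 := Hr1). rewrite <- C5.
    apply (cmc_radius_le lambda (q1 lambda al) _ _ Hl Hq).
    destruct (Rle_lt_dec t (PI / 2)) as [H'|H'].
    + apply sin_incr_1; lra.
    + pose proof (sin_ge_0 t ltac:(lra) ltac:(lra)).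
      pose proof (sin_lt_0_var (theta1bar beta A rbar) ltac:(lra) ltac:(lra)). lra.
Qed.

Lemma gamma2_radius_decreasing (beta A rbar lambda s t : R) :
  lambda < 0 -> 0 <= s -> s < t -> t <= PI / 2 ->
  cr (gamma2 beta A rbar lambda) t < cr (gamma2 beta A rbar lambda) s.
Proof.
  intros Hl Hs Hst Ht.
  apply (cmc_radius_decreasing lambda (q2 lambda) _ _ Hl (q2_pos lambda Hl)).
  apply sin_increasing_1; lra.
Qed.

Lemma gamma2_height_ge (beta A rbar lambda t : R) :
  lambda < 0 -> 0 <= t <= theta2bar beta A rbar -> theta2bar beta A rbar <= PI ->
  zbar A rbar <= cz (gamma2 beta A rbar lambda) t.
Proof.
  intros Hl Ht Ht2.
  destruct (proj2 Ht) as [H|H].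
  - left.
    rewrite <- (cmc_start lambda (q2 lambda) (theta2bar beta A rbar) (zbar A rbar)).
    apply (angle_curve_height_decreasing (gamma2 beta A rbar lambda)
      (cmc_weight lambda (q2 lambda)) 0 (theta2bar beta A rbar)); try lra.
    apply gamma2_angle_curve, Hl.
  - rewrite H. right. symmetry. apply cmc_start.
Qed.

(** * Intersections of the arcs *)

Lemma gamma1_start (beta A rbar lambda al : R) :
  cz (gamma1 beta A rbar lambda al) (theta1bar beta A rbar) = zbar A rbar.
Proof. apply cmc_start. Qed.

Lemma gamma2_start (beta A rbar lambda : R) :
  cz (gamma2 beta A rbar lambda) (theta2bar beta A rbar) = zbar A rbar.
Proof. apply cmc_start. Qed.

(** The tangent line of [gamma2] at the junction separates the two arcs.  The
    angles on [gamma2] lie between [0] and [theta2bar], so [gamma2] stays below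
    this line.  Those on [gamma1] start from [theta1bar], which is
    [theta2bar - (2 * beta - PI)] and so less than [PI] below the angle of the
    line; hence [gamma1] rises strictly above the line as long as its angle is
    at most [theta2bar].  Past angle [0] its radius is at most [al < rbar],
    whereas the radius on [gamma2] is at least [rbar]. *)
Lemma gamma12_meet (beta theta_c A rbar lambda al : R) :
  PI / 2 < beta < PI -> 0 < theta_c <= PI ->
  scalar_constraints beta theta_c A rbar lambda al ->
  meet_only_at
    (arc (gamma1 beta A rbar lambda al) (theta1bar beta A rbar) theta_c)
    (arc (gamma2 beta A rbar lambda) 0 (theta2bar beta A rbar))
    (rbar, zbar A rbar).
Proof.
  intros Hb Hc HS.
  pose proof (constrained_angles _ _ _ _ _ _ Hb HS) as (Ht1 & Ht2 & Ht23 & Ht3).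
  destruct HS as (_ & Hl & (Ha & _) & (C4 & _) & C5 & _).
  assert (Hdiff : theta2bar beta A rbar - theta1bar beta A rbar = 2 * beta - PI)
    by (unfold theta1bar, theta2bar; ring).
  pose proof (gamma1_start beta A rbar lambda al) as Z1.
  pose proof (gamma2_start beta A rbar lambda) as Z2.
  set (c1 := gamma1 beta A rbar lambda al) in *.
  set (c2 := gamma2 beta A rbar lambda) in *.
  set (t1 := theta1bar beta A rbar) in *.
  set (t2 := theta2bar beta A rbar) in *.
  intros q. split.
  - intros [(s & Hs & ->) (t & Ht & E)]. apply pair_equal_spec in E as [Er Ez].
    assert (Hr2 : rbar <= cr c2 t).
    { rewrite C4. destruct (proj2 Ht) as [H|H]; [|rewrite H; apply Rle_refl].
      left. apply gamma2_radius_decreasing; lra. }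
    destruct (Rlt_or_le 0 s) as [Hs0|Hs0].
    + exfalso.
      pose proof (gamma1_radius_left beta A rbar lambda al s Hl Ha ltac:(lra)) as H1.
      pose proof (gamma1_radius_right beta A rbar lambda al t1 Hl Ha ltac:(lra)) as H2.
      fold c1 in H1, H2. lra.
    + destruct (proj1 Hs) as [Hs1|<-]; [exfalso|rewrite C5, Z1; reflexivity].
      pose proof (line_offset_increasing c1 _ t1 0 t2 t1 s
        (gamma1_angle_curve beta A rbar lambda al _ _ Hl Ha)) as Habove.
      specialize (Habove ltac:(lra) Hs1 Hs0 ltac:(lra) ltac:(lra) t1).
      assert (Hbelow : line_offset c2 t2 t2 t <= line_offset c2 t2 t2 t2).
      { destruct (proj2 Ht) as [H|H]; [|rewrite H; apply Rle_refl].
        left. apply (line_offset_increasing c2 _ 0 t2 t2 t t2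
          (gamma2_angle_curve beta A rbar lambda _ _ Hl)); lra. }
      unfold line_offset in Habove, Hbelow.
      rewrite Z1, C5, Er, Ez in Habove. rewrite Z2, <- C4 in Hbelow.
      lra.
  - intros ->. split.
    + exists t1. split; [lra|]. rewrite C5, Z1. reflexivity.
    + exists t2. split; [lra|]. rewrite <- C4, Z2. reflexivity.
Qed.

Lemma gamma23_meet (beta theta_c A rbar lambda al : R) :
  PI / 2 < beta < PI ->
  scalar_constraints beta theta_c A rbar lambda al ->
  meet_only_at
    (arc (gamma2 beta A rbar lambda) 0 (theta2bar beta A rbar))
    (arc (gamma3 A) (theta3bar A rbar) (PI / 2))
    (rbar, zbar A rbar).
Proof.
  intros Hb HS.
  pose proof (constrained_angles _ _ _ _ _ _ Hb HS) as (Ht1 & Ht2 & Ht23 & Ht3).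
  destruct HS as ((HA & HAr & _) & Hl & _ & (C4 & _) & _).
  destruct (catenary_junction A rbar HA HAr) as (_ & R3 & Z3).
  pose proof (gamma2_start beta A rbar lambda) as Z2.
  intros q. split.
  - intros [(s & Hs & ->) (t & Ht & E)]. apply pair_equal_spec in E as [Er Ez].
    destruct (proj2 Hs) as [H|H].
    + exfalso.
      pose proof (gamma2_radius_decreasing beta A rbar lambda s _ Hl (proj1 Hs) H
        ltac:(lra)).
      pose proof (catenary_radius_bounds A _ t HA (proj1 Ht3) Ht). lra.
    + rewrite H, <- C4, Z2. reflexivity.
  - intros ->. split.
    + exists (theta2bar beta A rbar). split; [lra|]. rewrite <- C4, Z2. reflexivity.
    + exists (theta3bar A rbar). split; [lra|]. rewrite R3, Z3. reflexivity.
Qed.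

(** While its angle is negative, [gamma1] is higher than the junction, the top
    point of the catenary arc; afterwards its radius is at most the neck radius
    [al], and the catenary has radius at least [A]. *)
Lemma gamma13_meet_of_neck (beta theta_c A rbar lambda al : R) :
  PI / 2 < beta < PI -> 0 < theta_c <= PI ->
  scalar_constraints beta theta_c A rbar lambda al ->
  al < A ->
  gamma13_constraint beta theta_c A rbar lambda al.
Proof.
  intros Hb Hc HS HaA.
  pose proof (constrained_angles _ _ _ _ _ _ Hb HS) as (Ht1 & Ht2 & Ht23 & Ht3).
  destruct HS as ((HA & HAr & _) & Hl & (Ha & _) & _ & C5 & _).
  destruct (catenary_junction A rbar HA HAr) as (_ & R3 & Z3).
  pose proof (gamma1_start beta A rbar lambda al) as Z1.
  intros q. split.
  - intros [(s & Hs & ->) (t & Ht & E)]. apply pair_equal_spec in E as [Er Ez].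
    destruct (Rlt_or_le 0 s) as [Hs0|Hs0].
    + exfalso.
      pose proof (gamma1_radius_left beta A rbar lambda al s Hl Ha ltac:(lra)).
      pose proof (catenary_radius_bounds A _ t HA (proj1 Ht3) Ht). lra.
    + destruct (proj1 Hs) as [Hs1|<-]; [exfalso|rewrite C5, Z1; reflexivity].
      pose proof (gamma1_height_left beta A rbar lambda al s Hl Ha ltac:(lra) ltac:(lra)).
      assert (cz (gamma3 A) t <= cz (gamma3 A) (theta3bar A rbar)).
      { destruct (proj1 Ht) as [H1|<-]; [|lra].
        left. apply catenary_height_decreasing; lra. }
      lra.
  - intros ->. split.
    + exists (theta1bar beta A rbar). split; [lra|]. rewrite C5, Z1. reflexivity.
    + exists (theta3bar A rbar). split; [lra|]. rewrite R3, Z3. reflexivity.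
Qed.

(** If [gamma1] ended on or to the right of the foot [A] of the catenary, then
    on its way down from height [zbar], where it lies to the left of the
    catenary, it would have to cross it. *)
Lemma gamma1_foot_left (beta theta_c A rbar lambda al : R) :
  PI / 2 < beta < PI -> 0 < theta_c <= PI ->
  scalar_constraints beta theta_c A rbar lambda al ->
  gamma13_constraint beta theta_c A rbar lambda al ->
  cr (gamma1 beta A rbar lambda al) theta_c < A.
Proof.
  intros Hb Hc HS H13.
  pose proof (constrained_angles _ _ _ _ _ _ Hb HS) as (Ht1 & Ht2 & Ht23 & Ht3).
  destruct HS as ((HA & HAr & _) & Hl & (Ha & _) & _ & C5 & C6 & _).
  destruct (catenary_junction A rbar HA HAr) as (_ & R3 & Z3).
  pose proof (zbar_pos A rbar HA HAr) as Hz.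
  pose proof (gamma1_height_left beta A rbar lambda al 0 Hl Ha ltac:(lra) ltac:(lra))
    as Hz0.
  pose proof (gamma1_radius_right beta A rbar lambda al _ Hl Ha Ht1) as Hal.
  rewrite C5 in Hal.
  pose proof (gamma1_angle_curve beta A rbar lambda al 0 theta_c Hl Ha) as Hc1.
  pose proof (catenary_cosh A (theta3bar A rbar) HA ltac:(lra)) as Hcosh.
  rewrite R3, Z3 in Hcosh.
  unfold gamma13_constraint in H13.
  set (c1 := gamma1 beta A rbar lambda al) in *.
  set (z := zbar A rbar) in *.
  assert (Hcz : forall t, 0 <= t <= theta_c -> continuity_pt (cz c1) t).
  { intros t Ht. destruct (Hc1 t Ht) as (_ & _ & _ & D).
    exact (is_derive_continuity_pt _ _ _ D). }
  assert (Hcr : forall t, 0 <= t <= theta_c -> continuity_pt (cr c1) t).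
  { intros t Ht. destruct (Hc1 t Ht) as (_ & _ & D & _).
    exact (is_derive_continuity_pt _ _ _ D). }
  apply Rnot_le_lt. intros Habs.
  (* At [ts], [gamma1] is back at the height of the junction. *)
  destruct (IVT_interv (fun t => z - cz c1 t) 0 theta_c) as (ts & Hts & Ets).
  { intros t Ht. apply continuity_pt_minus; [|apply Hcz, Ht].
    apply continuity_pt_const. intros ? ?; reflexivity. }
  { lra. } { lra. } { lra. }
  assert (Hgap : forall t, 0 <= t <= theta_c ->
    continuity_pt (fun t => cr c1 t - A * cosh (cz c1 t / A)) t).
  { intros t Ht. apply continuity_pt_minus; [apply Hcr, Ht|].
    apply (continuity_pt_scal (fun t => cosh (cz c1 t / A))).
    apply (continuity_pt_comp (fun t => cz c1 t / A) cosh).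
    - apply continuity_pt_mult; [apply Hcz, Ht|].
      apply continuity_pt_const. intros ? ?; reflexivity.
    - apply derivable_continuous_pt, derivable_pt_cosh. }
  assert (Hfoot : A * cosh (cz c1 theta_c / A) = A).
  { rewrite C6. unfold Rdiv. rewrite Rmult_0_l, cosh_0. ring. }
  assert (Hcross : exists t, ts <= t <= theta_c /\ cr c1 t = A * cosh (cz c1 t / A)).
  { destruct Habs as [Habs|Habs].
    - destruct (IVT_interv (fun t => cr c1 t - A * cosh (cz c1 t / A)) ts theta_c)
        as (t & Ht & Et).
      + intros t Ht. apply Hgap. lra.
      + destruct (proj2 Hts) as [H|H]; [exact H|]. rewrite H, C6 in Ets. lra.
      + replace (cz c1 ts) with z by lra. rewrite <- Hcosh.
        pose proof (gamma1_radius_left beta A rbar lambda al ts Hl Ha ltac:(lra)) as H.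
        fold c1 in H. lra.
      + lra.
      + exists t. split; [exact Ht|lra].
    - exists theta_c. split; [lra|]. lra. }
  destruct Hcross as (t & Ht & Et).
  assert (Hzt : 0 <= cz c1 t <= z).
  { split.
    - destruct (proj2 Ht) as [H|H]; [|rewrite H; lra].
      rewrite <- C6. left. apply gamma1_height_decreasing; lra.
    - replace z with (cz c1 ts) by lra. destruct (proj1 Ht) as [H|H]; [|rewrite H; lra].
      left. apply gamma1_height_decreasing; lra. }
  (* The catenary arc reaches every height between [0] and [zbar]; at equal
     heights, the equation [r = A * cosh (z / A)] makes the radii equal. *)
  assert (Hu : exists u, theta3bar A rbar <= u <= PI / 2 /\ cz (gamma3 A) u = cz c1 t).
  { destruct (proj2 Hzt) as [H1|H1];
      [|exists (theta3bar A rbar); rewrite Z3; split; lra].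
    destruct (proj1 Hzt) as [H0|H0];
      [|exists (PI / 2); rewrite (proj2 (catenary_foot A)); split; lra].
    destruct (IVT_interv (fun u => cz c1 t - cz (gamma3 A) u)
      (theta3bar A rbar) (PI / 2)) as (u & Hu & Eu).
    - intros u Hu. apply continuity_pt_minus.
      + apply continuity_pt_const. intros ? ?; reflexivity.
      + destruct (catenary_angle_curve A _ HA (proj1 Ht3) u Hu) as (_ & _ & _ & D).
        exact (is_derive_continuity_pt _ _ _ D).
    - lra.
    - rewrite Z3. lra.
    - rewrite (proj2 (catenary_foot A)). lra.
    - exists u. split; [exact Hu|lra]. }
  destruct Hu as (u & Hu & Eu).
  assert (Hmeet : (cr c1 t, cz c1 t) = (rbar, z)).
  { apply H13. split.
    - exists t. split; [lra|reflexivity].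
    - exists u. split; [exact Hu|].
      rewrite (catenary_cosh A u HA ltac:(lra)), Eu, <- Et. reflexivity. }
  apply pair_equal_spec in Hmeet as [Er _].
  pose proof (gamma1_radius_left beta A rbar lambda al t Hl Ha ltac:(lra)) as H.
  fold c1 in H. lra.
Qed.

(** * The equivalence *)

Lemma meet_only_at_ext (S S' T T' : R * R -> Prop) (p : R * R) :
  (forall q, S q <-> S' q) -> (forall q, T q <-> T' q) ->
  meet_only_at S T p <-> meet_only_at S' T' p.
Proof.
  intros HS HT. unfold meet_only_at.
  split; intros H q; specialize (H q); rewrite HS, HT in *; exact H.
Qed.

(** The parameters [phi1], [phi2], [phi3] are onto their angle intervals, so the
    pointwise conditions hold at every angle: at [0] for [al < 1], at [theta_c]
    for [0 < al], at [- PI / 2] when it is in range, and at the endpoints. *)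
Lemma constraints_of_steady_state (beta theta_c A rbar lambda al : R) :
  PI / 2 < beta < PI -> 0 < theta_c <= PI -> 0 < A <= rbar -> lambda <> 0 ->
  0 <= al ->
  family_is_steady_state beta theta_c A rbar lambda al ->
  scalar_constraints beta theta_c A rbar lambda al /\
  gamma13_constraint beta theta_c A rbar lambda al.
Proof.
  intros Hb Hc HA Hl0 Hal
    ((T1 & T1' & T2 & T23 & T3) & phi1 & phi2 & phi3 & P1 & P2 & P3 &
     c1' & c2' & c3' & c1'' & c2'' & c3'' & _ & Hr13 & _ & _ & _ &
     (r1s & r3s & z2s & rb & zb & (_ & _ & _ & _ & Hrb & _) &
      (_ & Hz10 & Hr11 & Hz11) & (Hr20 & _) & (_ & _ & Hr31 & _) & _ &
      _ & M13 & _) & _).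
  assert (HAr : A < rbar).
  { destruct (proj2 HA) as [H|H]; [exact H|exfalso].
    unfold theta3bar in T3. replace (A / rbar) with 1 in T3 by (field_simplify_eq; lra).
    rewrite asin_1 in T3. lra. }
  destruct (catenary_junction A rbar (proj1 HA) HAr) as (Ht3 & R3 & _).
  pose proof P1 as (P10 & P11 & _ & P1s & _).
  pose proof P2 as (P20 & _).
  pose proof P3 as (_ & P31 & _).
  cbn [reparam cr cz] in Hz10, Hr11, Hz11, Hr20, Hr31.
  rewrite P10 in Hz10. rewrite P11 in Hr11, Hz11. rewrite P20 in Hr20.
  rewrite P31, R3 in Hr31. rewrite <- Hr31 in Hr11, Hr20, Hrb, M13.
  rewrite gamma1_start in Hz11. rewrite <- Hz11 in M13.
  assert (Hl : lambda < 0).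
  { destruct (Rtotal_order lambda 0) as [H|[H|H]]; [exact H|contradiction|exfalso].
    change (cmc_radius lambda (q2 lambda) (sin (theta2bar beta A rbar)) = rbar) in Hr20.
    unfold cmc_radius in Hr20.
    assert (Hq : 0 < q2 lambda) by (unfold q2; nra).
    destruct (abs_lt_sqrt (q2 lambda) (sin (theta2bar beta A rbar)) Hq) as [Hs _].
    set (s := sin _) in *. set (y := sqrt _) in *.
    assert ((s - y) / (2 * lambda) * (2 * lambda) = s - y) by (field; lra).
    nra. }
  assert (Hr1 : forall t, theta1bar beta A rbar <= t <= theta_c ->
    0 < cr (gamma1 beta A rbar lambda al) t < 1).
  { intros t Ht. destruct (P1s t Ht) as (x & Hx & <-). apply (Hr13 x Hx). }
  assert (Ha0 : 0 < al).
  { destruct Hal as [H|H]; [exact H|exfalso].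
    pose proof (proj1 (Hr1 theta_c ltac:(lra))) as H0. simpl in H0.
    subst al. replace (sin theta_c * (sin theta_c * 1) + 4 * (lambda * (lambda * 1)) * (0 * (0 * 1)))
      with (sin theta_c ^ 2) in H0 by ring.
    rewrite sqrt_pow2 in H0 by (apply sin_ge_0; lra).
    replace ((sin theta_c - sin theta_c) / (2 * lambda)) with 0 in H0 by (field; lra).
    lra. }
  split.
  - repeat split; try lra.
    + pose proof (proj2 (Hr1 0 ltac:(lra))) as H1.
      change (cmc_radius lambda (q1 lambda al) (sin 0) < 1) in H1.
      rewrite sin_0 in H1. unfold q1 in H1. rewrite cmc_radius_0 in H1; lra.
    + simpl. field. exact Hl0.
    + intros H. apply Hr1. lra.
  - apply (meet_only_at_ext _ _ _ _ _
      (arc_reparam _ _ _ _ P1) (arc_reparam _ _ _ _ P3)). exact M13.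
Qed.

Lemma steady_state_of_constraints (beta theta_c A rbar lambda al : R) :
  PI / 2 < beta < PI -> 0 < theta_c <= PI ->
  scalar_constraints beta theta_c A rbar lambda al ->
  gamma13_constraint beta theta_c A rbar lambda al ->
  family_is_steady_state beta theta_c A rbar lambda al.
Proof.
  intros Hb Hc HS H13.
  pose proof (constrained_angles _ _ _ _ _ _ Hb HS) as (Ht1 & Ht2 & Ht23 & Ht3).
  pose proof (gamma1_foot_left _ _ _ _ _ _ Hb Hc HS H13) as Hfoot.
  pose proof (gamma12_meet _ _ _ _ _ _ Hb Hc HS) as H12.
  pose proof (gamma23_meet _ _ _ _ _ _ Hb HS) as H23.
  pose proof (gamma1_radius_lt_1 beta theta_c A rbar lambda al) as Hr1.
  specialize (fun t => Hr1 t Hb (proj2 Hc) HS).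
  destruct HS as ((HA & HAr & Hrb) & Hl & (Ha & Ha1) & (C4 & _) & C5 & C6 & _).
  destruct (catenary_junction A rbar HA HAr) as (_ & R3 & Z3).
  pose proof (catenary_foot A) as [R3f Z3f].
  pose proof (zbar_pos A rbar HA HAr) as Hz.
  pose proof (q1_pos lambda al Hl Ha) as Hq1.
  pose proof (q2_pos lambda Hl) as Hq2.
  pose proof (gamma1_start beta A rbar lambda al) as Z1.
  pose proof (gamma2_start beta A rbar lambda) as Z2.
  pose proof PI_RGT_0 as Hpi.
  assert (Hp1 : forall t, 0 < cr (gamma1 beta A rbar lambda al) t)
    by (intros t; apply (cmc_radius_pos lambda (q1 lambda al) (sin t) Hl Hq1)).
  assert (Hp2 : forall t, 0 < cr (gamma2 beta A rbar lambda) t)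
    by (intros t; apply (cmc_radius_pos lambda (q2 lambda) (sin t) Hl Hq2)).
  assert (R20 : cr (gamma2 beta A rbar lambda) 0 = 1).
  { rewrite <- (q2_radius_0 lambda Hl). rewrite <- sin_0 at 2. reflexivity. }
  assert (Hz2 : forall t, 0 <= t <= theta2bar beta A rbar ->
    0 < cz (gamma2 beta A rbar lambda) t).
  { intros t Ht. apply Rlt_le_trans with (1 := Hz). apply gamma2_height_ge; lra. }
  assert (Hz1 : forall t, theta1bar beta A rbar <= t < theta_c ->
    0 < cz (gamma1 beta A rbar lambda al) t).
  { intros t Ht. destruct (Rle_or_lt t 0) as [H|H].
    - destruct (proj1 Ht) as [H1|<-]; [|lra].
      apply Rlt_trans with (1 := Hz). apply gamma1_height_left; lra.
    - rewrite <- C6. apply gamma1_height_decreasing; lra. }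
  assert (Hp3 : forall t, theta3bar A rbar <= t <= PI / 2 ->
    0 < cr (gamma3 A) t < 1).
  { intros t Ht. pose proof (catenary_radius_bounds A _ t HA (proj1 Ht3) Ht). lra. }
  destruct (angle_curve_reparam (gamma1 beta A rbar lambda al)
    (cmc_weight lambda (q1 lambda al)) (theta1bar beta A rbar) theta_c)
    as (phi1 & c1' & c1'' & P1 & D1 & S1 & T1 & K1); try lra.
  { apply gamma1_angle_curve; assumption. }
  { intros t _. apply Rgt_not_eq, Hp1. }
  destruct (angle_curve_reparam (gamma2 beta A rbar lambda)
    (cmc_weight lambda (q2 lambda)) 0 (theta2bar beta A rbar))
    as (phi2 & c2' & c2'' & P2 & D2 & S2 & T2 & K2); try lra.
  { apply gamma2_angle_curve; assumption. }
  { intros t _. apply Rgt_not_eq, Hp2. }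
  destruct (angle_curve_reparam (gamma3 A) (fun t => A / sin t ^ 2)
    (theta3bar A rbar) (PI / 2))
    as (phi3 & c3' & c3'' & P3 & D3 & S3 & T3 & K3); try lra.
  { apply catenary_angle_curve; lra. }
  { intros t Ht. apply Rgt_not_eq, Hp3, Ht. }
  pose proof (decreasing_arclength_param_bounds _ _ _ _ P1) as B1.
  pose proof (decreasing_arclength_param_bounds _ _ _ _ P2) as B2.
  pose proof (decreasing_arclength_param_bounds _ _ _ _ P3) as B3.
  pose proof P1 as (P10 & P11 & P1d & _).
  pose proof P2 as (P20 & P21 & P2d & _).
  pose proof P3 as (P30 & P31 & P3d & _).
  split; [lra|].
  exists phi1, phi2, phi3. split; [exact P1|]. split; [exact P2|]. split; [exact P3|].
  exists c1', c2', c3', c1'', c2'', c3''.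
  split; [split; [exact D1|split; assumption]|].
  split; [|split; [|split; [|split; [|split; [|split; [|split]]]]]];
    cbn [reparam cr cz].
  - intros x Hx. split.
    + split; [apply Hp1|apply Hr1, B1, Hx].
    + apply Hp3, B3, Hx.
  - intros x Hx. split; [apply Hp2|]. rewrite <- R20.
    pose proof (P2d x 1 (proj1 Hx) (proj2 Hx) ltac:(lra)) as H.
    rewrite P21 in H. pose proof (B2 x ltac:(unfold I01; lra)).
    apply gamma2_radius_decreasing; lra.
  - intros x Hx. split.
    + apply Hz1. pose proof (P1d 0 x ltac:(lra) (proj1 Hx) (proj2 Hx)) as H.
      rewrite P10 in H. pose proof (B1 x ltac:(unfold I01; lra)). lra.
    + pose proof (P3d 0 x ltac:(lra) (proj1 Hx) (proj2 Hx)) as H.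
      rewrite P30 in H. pose proof (B3 x ltac:(unfold I01; lra)).
      rewrite <- Z3f. apply catenary_height_decreasing; lra.
  - intros x Hx. apply Hz2, B2, Hx.
  - exists (cr (gamma1 beta A rbar lambda al) theta_c), A,
      (cz (gamma2 beta A rbar lambda) 0), rbar, (zbar A rbar).
    rewrite P10, P11, P20, P21, P30, P31.
    pose proof (Hz2 0 ltac:(lra)).
    split; [repeat split; try lra; apply Hp1|].
    split; [repeat split; assumption|].
    split; [repeat split; try assumption; symmetry; assumption|].
    split; [repeat split; assumption|].
    split; [split; [|split]|split; [|split]].
    + apply (simple_reparam _ _ _ _ P1). intros s t Hs Ht.
      apply (gamma1_injective beta A rbar lambda al theta_c); try assumption; lra.
    + apply (simple_reparam _ _ _ _ P2). intros s t Hs Ht Er _.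
      destruct (Rtotal_order s t) as [H'|[H'|H']]; [exfalso|exact H'|exfalso].
      * pose proof (gamma2_radius_decreasing beta A rbar lambda s t Hl). lra.
      * pose proof (gamma2_radius_decreasing beta A rbar lambda t s Hl). lra.
    + apply (simple_reparam _ _ _ _ P3). intros s t Hs Ht _ Ez.
      destruct (Rtotal_order s t) as [H'|[H'|H']]; [exfalso|exact H'|exfalso].
      * pose proof (catenary_height_decreasing A s t HA). lra.
      * pose proof (catenary_height_decreasing A t s HA). lra.
    + apply (meet_only_at_ext _ _ _ _ _
        (arc_reparam _ _ _ _ P1) (arc_reparam _ _ _ _ P2)). exact H12.
    + apply (meet_only_at_ext _ _ _ _ _
        (arc_reparam _ _ _ _ P1) (arc_reparam _ _ _ _ P3)). exact H13.
    + apply (meet_only_at_ext _ _ _ _ _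
        (arc_reparam _ _ _ _ P2) (arc_reparam _ _ _ _ P3)). exact H23.
  - split; [exact S1|split; assumption].
  - exists lambda. intros x Hx.
    rewrite K1, K2, K3 by exact Hx. split; [|split].
    + apply (cmc_curvature lambda (q1 lambda al) (phi1 x) Hl Hq1).
    + apply (cmc_curvature lambda (q2 lambda) (phi2 x) Hl Hq2).
    + simpl. pose proof (B3 x Hx).
      pose proof (sin_gt_0 (phi3 x) ltac:(lra) ltac:(lra)).
      field. split; lra.
  - exists phi1, phi2, phi3. split; [split; [exact T1|split; assumption]|].
    unfold theta1bar, theta2bar in *. repeat split; try assumption; lra.
Qed.

Theorem theorem4p11 :
  forall beta theta_c A rbar lambda al : R,
    PI / 2 < beta < PI ->
    0 < theta_c <= PI ->
    0 < A <= rbar ->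
    lambda <> 0 ->
    0 <= al ->
    (family_is_steady_state beta theta_c A rbar lambda al <->
       scalar_constraints beta theta_c A rbar lambda al /\
       gamma13_constraint beta theta_c A rbar lambda al) /\
    (scalar_constraints beta theta_c A rbar lambda al ->
     al < A ->
     gamma13_constraint beta theta_c A rbar lambda al).
Proof.
  intros beta theta_c A rbar lambda al Hb Hc HA Hl Ha. split; [split|].
  - apply constraints_of_steady_state; assumption.
  - intros [HS H13]. apply steady_state_of_constraints; assumption.
  - apply gamma13_meet_of_neck; assumption.
Qed.
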